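(* Consider the parameter estimator $\dot{\hat\theta}=u$, $\hat\theta\in\mathbb R^n$, with nominal update law $u_0=u_0(\hat\theta,\xi,t)$ (possibly dependent on an additional state $\xi$). Let $\alpha\in\mathcal K_h$, let $h(\hat\theta)$ be a CBF for $\dot{\hat\theta}=u$, and let $$\bar u_{\rm QP}=\frac{\Big(\frac{\partial h}{\partial\hat\theta}\Big)^T}{\Big|\frac{\partial h}{\partial\hat\theta}\Big|^2}\max\Big\{0,-\frac{\partial h}{\partial\hat\theta}u_0-\alpha(h(\hat\theta))\Big\}.$$ Then, for any $\beta\ge2$, the update law $\dot{\hat\theta}=u$ with $u=u_0+\beta\bar u_{\rm QP}$ minimizes (over admissible $u-u_0$) $$J(u-u_0)=\lim_{t\to\infty}\Bigg[-2\beta h(\hat\theta)+\int_0^t\Bigg(l(\hat\theta,u_0)+\frac{\Big|\frac{\partial h}{\partial\hat\theta}\Big|^2|u-u_0|^2}{\max\Big\{0,-\frac{\partial h}{\partial\hat\theta}u_0-\alpha(h(\hat\theta))\Big\}}\Bigg)d\tau\Bigg],$$ where $$l(\hat\theta,u_0)=2\beta\frac{\partial h}{\partial\hat\theta}u_0+\beta^2\max\Big\{0,-\frac{\partial h}{\partial\hat\theta}u_0-\alpha(h(\hat\theta))\Big\}\ \ge\ -2\beta\,\alpha(h(\hat\theta)).$$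
   Context: $h:\mathbb R^n\to\mathbb R$ is a barrier function candidate: differentiable with $\inf h<0<\sup h$. $\mathcal K_h$: continuous strictly increasing functions $(\inf h,\sup h)\to\mathbb R$ vanishing at $0$; $\alpha(h(\hat\theta))$ is understood to be defined for all $\hat\theta$. $h$ is a CBF for $\dot{\hat\theta}=u$ means: $\frac{\partial h}{\partial\hat\theta}=0\Rightarrow\alpha(h(\hat\theta))\ge0$. $\frac{\partial h}{\partial\hat\theta}$ is a row vector; $|\cdot|$ is the Euclidean norm. Conventions: $\bar u_{\rm QP}=0$ whenever $-\frac{\partial h}{\partial\hat\theta}u_0-\alpha(h)\le0$ (in particular whenever $\frac{\partial h}{\partial\hat\theta}=0$). Where $\max\{0,-\frac{\partial h}{\partial\hat\theta}u_0-\alpha(h)\}=0$ the weight on $|u-u_0|^2$ is $+\infty$: the penalty equals $0$ if $u=u_0$ and $+\infty$ otherwise. Admissible $u-u_0$ are locally bounded functions for which solutions exist on $[0,\infty)$ and the limit in $J$ exists (in the extended reals); $\beta\bar u_{\rm QP}$ is taken to be admissible. In $J$, $\hat\theta$ outside the integral is evaluated at time $t$, along the solution from a given initial condition. ''Minimizes'' means $J(u-u_0)\ge J(\beta\bar u_{\rm QP})$ for all admissible $u-u_0$. *)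

(* Defs.v *)
From HB Require Import structures.
From mathcomp Require Import all_boot all_order all_algebra.
From mathcomp Require Import all_classical all_reals all_analysis.
From mathcomp Require Import measurable_realfun.

Set Implicit Arguments.
Unset Strict Implicit.
Unset Printing Implicit Defensive.

Import Order.TTheory GRing.Theory Num.Theory.
Import numFieldNormedType.Exports.

Local Open Scope classical_set_scope.
Local Open Scope ring_scope.

(* The library norm on matrices is the sup norm. *)
Definition enorm {R : realType} {p q : nat} (A : 'M[R]_(p, q)) : R :=
  Num.sqrt (\sum_i \sum_j A i j ^+ 2).

Section BarrierFunctions.
Context {R : realType} {n : nat}.
Implicit Types (h : 'cV[R]_n -> R) (alpha : R -> R) (x u : 'cV[R]_n).

Definition grad h x : 'rV[R]_n := \row_i 'D_(delta_mx i 0) h x.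

Definition infh h : \bar R := ereal_inf [set (h x)%:E | x in setT].
Definition suph h : \bar R := ereal_sup [set (h x)%:E | x in setT].

Definition barrier_candidate h : Prop :=
  (forall x, differentiable h x) /\ (infh h < 0 < suph h)%E.

Definition Kh_domain h : set R := [set y | (infh h < y%:E < suph h)%E].

(* The values of alpha outside the open interval are unconstrained; they are
   relevant only where h attains its infimum or its supremum. *)
Definition class_Kh h alpha : Prop :=
  [/\ forall y, Kh_domain h y -> {for y, continuous alpha},
      forall y z, Kh_domain h y -> Kh_domain h z -> y < z -> alpha y < alpha z
    & alpha 0 = 0].

(* CBF for the integrator dx/dt = u, with respect to alpha. *)
Definition is_CBF h alpha : Prop := forall x, grad h x = 0 -> 0 <= alpha (h x).

Definition deficit h alpha x u : R :=
  Num.max 0 (- (grad h x *m u) 0 0 - alpha (h x)).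

(* Since 0^-1 = 0, this vanishes where grad h x = 0. *)
Definition uQP h alpha x u : 'cV[R]_n :=
  (deficit h alpha x u / enorm (grad h x) ^+ 2) *: (grad h x)^T.

Definition state_cost h alpha (beta : R) x u : R :=
  2 * beta * (grad h x *m u) 0 0 + beta ^+ 2 * deficit h alpha x u.

(* u is the nominal input u0 and w is the correction u - u0; the weight of |w|^2
   is +oo where the deficit is 0. *)
Definition penalty h alpha x u (w : 'cV[R]_n) : \bar R :=
  let m := deficit h alpha x u in
  if m == 0 then (if w == 0 then 0%E else +oo%E)
  else (enorm (grad h x) ^+ 2 * enorm w ^+ 2 / m)%:E.

End BarrierFunctions.

(* The Lebesgue integral of f over D is defined in [-oo, +oo]; the library
   integral is total. *)
Definition has_integral {R : realType} (D : set R) (f : R -> \bar R) : Prop :=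
  measurable_fun D f /\
  ((\int[lebesgue_measure]_(s in D) f^\+ s < +oo)%E \/
   (\int[lebesgue_measure]_(s in D) f^\- s < +oo)%E).

(* Caratheodory solution on [0, +oo) of dx/dt = u(t), x(0) = x0. *)
Definition solution {R : realType} {n : nat}
    (u : R -> 'cV[R]_n) (x0 : 'cV[R]_n) (x : R -> 'cV[R]_n) : Prop :=
  forall (t : R) (i : 'I_n), 0 <= t ->
    lebesgue_measure.-integrable `[0, t] (fun s => (u s i 0)%:E) /\
    x t i 0 = x0 i 0 + \int[lebesgue_measure]_(s in `[0, t]) (u s i 0).

(* th and xi are the trajectories of the estimate and of the additional state,
   w is the value of u - u0 along them; a feedback law enters through the
   signal w that it generates along its solution. *)
Section CostFunctional.
Context {R : realType} {n : nat} {X : Type}.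
Variables (h : 'cV[R]_n -> R) (alpha : R -> R) (beta : R).
Variable u0 : 'cV[R]_n -> X -> R -> 'cV[R]_n.
Implicit Types (th w : R -> 'cV[R]_n) (xi : R -> X).

Definition running_cost th xi w (s : R) : \bar R :=
  ((state_cost h alpha beta (th s) (u0 (th s) (xi s) s))%:E +
   penalty h alpha (th s) (u0 (th s) (xi s) s) (w s))%E.

Definition cost_upto th xi w (t : R) : \bar R :=
  ((- (2 * beta * h (th t)))%:E +
   \int[lebesgue_measure]_(s in `[0%R, t]) running_cost th xi w s)%E.

Definition J th xi w : \bar R := lim (cost_upto th xi w t @[t --> +oo]).

(* xi_sys th xi : xi is a trajectory of the additional state compatible with
   the estimate trajectory th. *)
Definition admissible (xi_sys : (R -> 'cV[R]_n) -> (R -> X) -> Prop)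
    (th0 : 'cV[R]_n) (xi0 : X) th xi w : Prop :=
  [/\ forall T : R, [bounded w s | s in `[0, T]],
      solution (fun s => u0 (th s) (xi s) s + w s) th0 th,
      xi_sys th xi /\ xi 0 = xi0,
      forall t : R, 0 <= t -> has_integral `[0, t] (running_cost th xi w)
    & cvg (cost_upto th xi w t @[t --> +oo])].

Definition QP_correction th xi (s : R) : 'cV[R]_n :=
  beta *: uQP h alpha (th s) (u0 (th s) (xi s) s).

End CostFunctional.

(* Main.v *)
(* Where the deficit m is positive, the running cost is 2 beta times the
   derivative of h along the velocity u0 + w, plus the nonnegative term
   (|grad h|^2 / m) |w - beta uQP|^2; where m = 0, it is that derivative term if
   w = 0 and +oo otherwise.  Hence the cost up to time t is at least
   - 2 beta h(theta(0)), with equality for w = beta uQP, provided that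
   h(theta(t)) - h(theta(0)) is bounded by the integral of any upper bound of
   that derivative.  Since h is merely differentiable, h o theta need not be
   absolutely continuous, so this is proved directly: the chain rule applies at
   almost every time, and at a time s of the remaining null set the right
   increments of h o theta are at most C(s) times the variation of theta, which
   is dominated by the increments of a nondecreasing function of arbitrarily
   small total variation.  A one-sided integrability condition on the bound
   suffices, by truncation and monotone convergence. *)
Require Import Defs.
From HB Require Import structures.
From mathcomp Require Import all_boot all_order all_algebra.
From mathcomp Require Import all_classical all_reals all_analysis.
From mathcomp Require Import measurable_realfun.
From mathcomp Require Import ring lra.
Import Order.TTheory GRing.Theory Num.Theory.
Import numFieldNormedType.Exports.
Local Open Scope classical_set_scope.
Local Open Scope ring_scope.

(** * Real-variable and measure-theoretic tools *)

(** Induction along the interval: the supremum of the times satisfying the bound satisfies it too,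
    by left continuity of [A] and monotonicity of [psi], so [psi] may jump. The bound on right
    increments then rules out a supremum below [T]. *)
Lemma increment_le_nondecreasing (R : realType) (A psi : R -> R) (T : R) :
  0 <= T ->
  (forall t, 0 < t <= T -> A s @[s --> t^'-] --> A t) ->
  {homo psi : s t / s <= t} ->
  (forall t, 0 <= t < T -> \forall s \near t^'+, A s - A t <= psi s - psi t) ->
  A T - A 0 <= psi T - psi 0.
Proof.
move=> T0 Al ndpsi Ar.
pose S := [set t | 0 <= t <= T /\ A t - A 0 <= psi t - psi 0].
have S0 : S 0 by split; rewrite ?lexx ?T0 //; lra.
have supS : has_sup S.
  by split; [exists 0 | exists T => x [/andP[]]].
have c0 : 0 <= sup S by apply: ub_le_sup => //; case: supS.
have cT : sup S <= T by apply: ge_sup => [|x [/andP[]]]; [exists 0 | ].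
have Sc : S (sup S).
  apply: contrapT => nSc.
  have {nSc} Ac : psi (sup S) - psi 0 + A 0 < A (sup S).
    rewrite ltNge; apply/negP => Ac; apply: nSc; split; [by rewrite c0 | lra].
  have cp : 0 < sup S.
    rewrite lt_def c0 andbT; apply/eqP => e; move: Ac; rewrite e; lra.
  have /Al /cvgr_gt /(_ _ Ac) : 0 < sup S <= T by rewrite cp.
  move=> [d /= d0 near_c].
  have [x Sx xc] := sup_adherent d0 supS.
  have xle : x <= sup S by apply: ub_le_sup => //; case: supS.
  have [xE|xne] := eqVneq x (sup S).
    by case: Sx => _; rewrite xE; move: Ac; lra.
  have xlt : x < sup S by rewrite lt_neqAle xne.
  have /= := near_c x; rewrite /ball_ /= gtr0_norm ?subr_gt0// => /(_ _ xlt).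
  case: Sx => _ Sx; have := ndpsi _ _ xle => + H.
  have : psi (sup S) - psi 0 + A 0 < A x by apply: H; lra.
  by move: Sx; lra.
suff -> : T = sup S by case: Sc.
apply/eqP; rewrite eq_le cT andbT leNgt; apply/negP => cltT.
have /Ar : 0 <= sup S < T by rewrite c0.
move=> Arc; near (sup S)^'+ => s.
have As : A s - A (sup S) <= psi s - psi (sup S) by near: s.
have sT : s <= T by near: s; exact: nbhs_right_le.
have cs : sup S < s by near: s; exact: nbhs_right_gt.
case: Sc => _ Sc.
have : s <= sup S.
  apply: ub_le_sup; first by case: supS.
  by split; [rewrite sT (le_trans c0 (ltW cs)) | lra].
by rewrite leNgt cs.
Unshelve. all: by end_near. Qed.

Lemma ae_is_derive_integral (R : realType) (f : R -> R) :
  lebesgue_measure.-integrable setT (EFin \o f) ->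
  {ae @lebesgue_measure R, forall t : R, 0 < t ->
    is_derive t 1 (fun s => \int[lebesgue_measure]_(x in `[0, s]) f x) (f t)}.
Proof.
move=> intf.
have locf : locally_integrable setT f.
  by apply: open_integrable_locally => //; exact: openT.
have intf0 y : lebesgue_measure.-integrable `[0, y] (EFin \o f).
  exact: integrableS intf.
have := @FTC1 R f (BLeft 0) intf0 locf.
apply: filterS; first exact: (ae_filter_ringOfSetsType lebesgue_measure).
move=> t + t0 => /(_ _)[//|df f't].
by rewrite -f't derive1E; exact: derivableP.
Qed.

(** Absolute continuity of the integral gives a measure threshold [d]; outer regularity covers the
    null set by an open set of measure at most [d / 2], strictly below it. *)
Lemma negligible_small_integral_open (R : realType) (W : R -> R) (N : set R)
    (e : R) :
  lebesgue_measure.-integrable setT (EFin \o W) -> (forall x, 0 <= W x) ->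
  lebesgue_measure.-negligible N -> 0 < e ->
  exists U : set R, [/\ open U, N `<=` U &
    (\int[lebesgue_measure]_(x in U) (W x)%:E <= e%:E)%E].
Proof.
move=> intW W0 /negligible_outer_measure N0 e0.
have [d [d0 Wd]] := integral_normr_continuous intW e0.
have d20 : 0 < d / 2 by rewrite divr_gt0.
have [U [oU NU mU]] := outer_measure_open_le N d20.
have mmU : measurable U by exact: open_measurable.
exists U; split => //.
have /ltW : \int[lebesgue_measure]_(x in U) `|W x| < e.
  apply: Wd => //; apply: le_lt_trans mU _.
  by rewrite N0 add0e lte_fin; lra.
under eq_Rintegral do rewrite ger0_norm//.
rewrite -lee_fin fineK//; apply: integrable_fin_num => //.
exact: integrableS intW.
Qed.

(* psi s is the sum over k of the integrals of W over U k up to s, where the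
   open sets U k contain N and carry a summably small integral of W. *)
Lemma null_set_weight (R : realType) (W : R -> R) (N : set R) (e : R) :
  lebesgue_measure.-integrable setT (EFin \o W) -> (forall x, 0 <= W x) ->
  lebesgue_measure.-negligible N -> 0 < e ->
  exists psi : R -> R, [/\ {homo psi : s t / s <= t},
    forall s, 0 <= psi s <= e &
    forall t (K : nat), N t -> \forall s \near t^'+,
      K%:R * \int[lebesgue_measure]_(x in `]t, s]) W x <= psi s - psi t].
Proof.
move=> intW W0 N0 e0.
(* The budgets [e / 2 ^ k.+1] sum to [e]. *)
have /choice[U HU] k : exists U : set R, [/\ open U, N `<=` U &
    (\int[lebesgue_measure]_(x in U) (W x)%:E <= (e / (2 ^ k.+1)%:R)%:E)%E].
  by apply: negligible_small_integral_open => //; rewrite divr_gt0// ltr0n expn_gt0.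
have mU k : measurable (U k) by case: (HU k) => oU _ _; exact: open_measurable.
have mW A : measurable_fun A (EFin \o W).
  by have /integrableP[mW _] := intW; exact: measurable_funTS.
have subW A B : measurable A -> measurable B -> A `<=` B ->
    (\int[lebesgue_measure]_(x in A) (W x)%:E <=
     \int[lebesgue_measure]_(x in B) (W x)%:E)%E.
  move=> mA mB; apply: ge0_subset_integral => //; first exact: mW.
  by move=> x _; rewrite lee_fin.
pose m k s := (\int[lebesgue_measure]_(x in U k `&` `]-oo, s]) (W x)%:E)%E.
have mUI k s : measurable (U k `&` `]-oo, s]).
  by apply: measurableI; [exact: mU|exact: measurable_itv].
have m0 k s : (0 <= m k s)%E by apply: integral_ge0 => x _; rewrite lee_fin.
have m_le k s : (m k s <= (e / (2 ^ k.+1)%:R)%:E)%E.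
  case: (HU k) => _ _; apply: le_trans.
  by apply: subW; [exact: mUI|exact: mU|move=> x []].
have m_nd k s t : s <= t -> (m k s <= m k t)%E.
  move=> st; apply: subW; [exact: mUI|exact: mUI|].
  by apply: setIS; apply: subset_itvl; rewrite bnd_simp.
pose P s := (\sum_(0 <= k <oo) m k s)%E.
have P0 s : (0 <= P s)%E by apply: nneseries_ge0 => k _ _; exact: m0.
have Pe s : (P s <= e%:E)%E.
  apply: le_trans (epsilon_trick0 xpredT (ltW e0)).
  by apply: lee_nneseries => k *; [exact: m0|exact: m_le].
have Pfin s : P s \is a fin_num.
  by rewrite ge0_fin_numE// (le_lt_trans (Pe s))// ltry.
exists (fine \o P); split => /=.
- move=> s t st; apply: fine_le => //.
  by apply: lee_nneseries => k *; [exact: m0|exact: m_nd].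
- by move=> s; rewrite fine_ge0//= -lee_fin fineK.
move=> t K Nt.
(* Only [K] of the open sets are needed, so a whole neighbourhood of [t] lies in all of them. *)
have : \forall s \near nbhs t, forall k : 'I_K, U k s.
  apply: filter_forall => k; case: (HU k) => oU NU _.
  by apply: open_nbhs_nbhs; split => //; exact: NU.
move=> [d /= d0 Ud].
near=> s.
have ts : t < s by near: s; exact: nbhs_right_gt.
have sd : s < t + d.
  by near: s; apply: nbhs_right_lt; rewrite ltrDl.
have intts : lebesgue_measure.-integrable `]t, s] (EFin \o W).
  exact: integrableS intW.
pose c := (\int[lebesgue_measure]_(x in `]t, s]) (W x)%:E)%E.
have cfin : c \is a fin_num by exact: integrable_fin_num.
have c0 : (0 <= c)%E by apply: integral_ge0 => x _; rewrite lee_fin.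
rewrite lerBrDl -lee_fin EFinD EFinM !fineK// -/c.
(* Each of the first [K] terms gains the full integral [c] over []t, s]]; the others do not
   decrease. Summing over [k] yields the factor [K]. *)
have mK k : (m k t + (if (k < K)%N then c else 0) <= m k s)%E.
  case: ifPn => kK; last by rewrite adde0 m_nd// ltW.
  rewrite -ge0_integral_setU//=; last 4 first.
  - exact: mUI.
  - exact: mW.
  - by move=> x _; rewrite lee_fin.
  - apply/disj_setPS => x /= [[_]]; rewrite !in_itv/= => xt /andP[].
    by rewrite ltNge xt.
  apply: subW; [by apply: measurableU; [exact: mUI|exact: measurable_itv]|exact: mUI|].
  move=> x /= [[Ux]|]; rewrite !in_itv/=.
    by move=> xt; split => //; rewrite (le_trans xt)// ltW.
  move=> /andP[tx xs]; split=> //.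
  apply: (Ud x _ (Ordinal kK)).
  rewrite /ball_ /= ltr0_norm ?subr_lt0//; lra.
apply: (@le_trans _ _ (\sum_(0 <= k <oo) (m k t + (if (k < K)%N then c else 0)))%E).
  rewrite nneseriesD//; last by move=> i _ _; case: ifP.
  rewrite leeD2l//.
  apply: le_trans (nneseries_lim_ge K _); last by move=> i _ _; case: ifP.
  rewrite big_mkord (eq_bigr (fun=> c)) => [|i _]; last by rewrite ltn_ord.
  by rewrite sumr_const card_ord mule_natl.
apply: lee_nneseries => // k _ _; apply: adde_ge0 => //.
by case: ifP.
Unshelve. all: by end_near. Qed.

(** The constant is a bound of the differential plus 1, the latter absorbing the little-o
    remainder. *)
Lemma differentiable_near_lipschitz (R : realType) (V W : normedModType R)
    (f : V -> W) (x : V) :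
  differentiable f x ->
  exists2 k, 0 < k & \forall y \near x, `|f y - f x| <= k * `|y - x|.
Proof.
move=> df.
have [k k0 dk] := linear_lipschitz (diff_continuous df).
exists (k + 1); first by rewrite addr_gt0.
have /eqaddoP/(_ _ ltr01) /nbhs_ballP[e /= e0 He] := diff_locally df.
apply/nbhs_ballP; exists e => //= y; rewrite -ball_normE /= => xy.
have /He : ball 0 e (y - x) by rewrite -ball_normE /= sub0r opprB.
rewrite /= !fctE /= subrK mul1r => {}He.
rewrite -(subrK ('d f x (y - x)) (f y - f x)).
rewrite (le_trans (ler_normD _ _))// mulrDl mul1r addrC lerD//.
by move: He; rewrite opprD addrA.
Qed.

Lemma is_derive_near_right (R : realType) (A : R -> R) (t d e : R) :
  is_derive t 1 A d -> d < e ->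
  \forall s \near t^'+, A s - A t <= e * (s - t).
Proof.
move=> [dA <-] /(cvgr_lt _ dA) [r /= r0 Hr].
near=> s.
have ts : t < s by near: s; exact: nbhs_right_gt.
have sr : s < t + r by near: s; apply: nbhs_right_lt; rewrite ltrDl.
have st0 : 0 < s - t by rewrite subr_gt0.
have /= := Hr (s - t).
rewrite /ball_ /= sub0r normrN gtr0_norm// gt_eqF//.
rewrite [_%:A]mulr1 subrK => /(_ _ isT) H.
rewrite mulrC -ler_pdivrMl//; apply: ltW.
by apply: H; lra.
Unshelve. all: by end_near. Qed.

Lemma norm_increment_integral_le (R : realType) (f W : R -> R) (s t : R) :
  lebesgue_measure.-integrable setT (EFin \o f) ->
  lebesgue_measure.-integrable setT (EFin \o W) ->
  (forall x, `|f x| <= W x) -> 0 <= s <= t ->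
  `|\int[lebesgue_measure]_(x in `[0, t]) f x -
    \int[lebesgue_measure]_(x in `[0, s]) f x| <=
  \int[lebesgue_measure]_(x in `]s, t]) W x.
Proof.
move=> intf intW fW /andP[s0 st].
rewrite Rintegral_itvB//; last exact: integrableS intf.
apply: le_trans (le_normr_Rintegral _ _) _ => //.
  exact: integrableS intf.
apply: le_Rintegral => //.
  by apply: (integrable_norm _); exact: integrableS intf.
exact: integrableS intW.
Qed.

Lemma integral_oc_cvg0 (R : realType) (W : R -> R) (t : R) :
  lebesgue_measure.-integrable setT (EFin \o W) ->
  \int[lebesgue_measure]_(x in `]t, s]) W x @[s --> t^'+] --> (0 : R).
Proof.
move=> intW.
have intW' (D : set R) : measurable D ->
  lebesgue_measure.-integrable D (EFin \o W).
  by move=> mD; exact: integrableS intW.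
have -> : (fun s => \int[lebesgue_measure]_(x in `]t, s]) W x) =
    (fun s => \int[lebesgue_measure]_(x in `[t, s]) W x).
  by apply/funext => s; rewrite Rintegral_itv_obnd_cbnd//; exact: intW'.
apply: cvg_at_right_filter.
have tt1 : t < t + 1 by rewrite ltrDl.
exact: (parameterized_integral_cvg_left tt1 (intW' _ (measurable_itv _))).
Qed.

(** * Chain rule inequality along primitives of integrable velocities *)

Section ChainRuleInequality.
Context {R : realType} {n : nat}.
Notation mu := (@lebesgue_measure R).
Variables (v : R -> 'cV[R]_n) (th : R -> 'cV[R]_n) (x0 : 'cV[R]_n).
Hypothesis intv : forall i, mu.-integrable setT (fun s => (v s i 0)%:E).
Hypothesis thE : forall t i, th t i 0 = x0 i 0 + \int[mu]_(s in `[0, t]) v s i 0.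

(** The norm of columns is the sup norm, so a common bound [W] of the coordinates suffices without a
    dimension factor. *)
Lemma norm_col_increment_le (W : R -> R) (s t : R) :
  mu.-integrable setT (EFin \o W) -> (forall x i, `|v x i 0| <= W x) ->
  (forall x, 0 <= W x) -> 0 <= s <= t ->
  `|th t - th s| <= \int[mu]_(x in `]s, t]) W x.
Proof.
move=> intW vW W0 st.
rewrite [leLHS]/Num.Def.normr/= mx_normrE.
apply: bigmax_le; first by apply: Rintegral_ge0.
move=> [i j] _ /=; rewrite [j]ord1 !mxE !thE opprD addrACA subrr add0r.
apply: (norm_increment_integral_le _ (fun s => v s i 0)) => //.
exact: intv.
Qed.

Lemma primitive_left_continuous (t : R) : 0 < t -> th s @[s --> t^'-] --> th t.
Proof.
move=> t0; apply/cvgrPdist_le => /= e e0; near=> s.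
rewrite /Num.Def.normr/= mx_normrE (bigmax_le _ (ltW e0))//= => -[i j] _ /=.
rewrite [j]ord1 !mxE !thE opprD addrACA subrr add0r {j}.
move: i; near: s; apply: filter_forall => i.
have int0t : mu.-integrable `[0, t] (EFin \o (fun s => v s i 0)).
  exact: integrableS (intv i).
exact: (cvgrPdist_le _ _).1 (parameterized_integral_cvg_at_left t0 int0t) _ e0.
Unshelve. all: by end_near. Qed.

Lemma ae_is_derive_primitive :
  {ae mu, forall t : R, 0 < t -> is_derive t 1 th (v t)}.
Proof.
have : \forall t \near almost_everywhere mu, forall i : 'I_n, 0 < (t : R) ->
    is_derive (t : R) 1 (fun s => \int[mu]_(x in `[0, s]) v x i 0) (v t i 0).
  apply: filter_forall => i; exact: ae_is_derive_integral (intv i).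
apply: filterS; first exact: (ae_filter_ringOfSetsType mu).
move=> t dv t0.
have dth i : is_derive t 1 (fun s => th s i 0) (v t i 0).
  have -> : (fun s => th s i 0) =
      cst (x0 i 0) + (fun s => \int[mu]_(x in `[0, s]) v x i 0).
    by apply/funext => s; rewrite thE.
  have := dv i t0 => {}dv.
  by apply: is_derive_eq; rewrite add0r.
have dth' : derivable th t 1.
  by apply/derivable_mxP => i j; rewrite [j]ord1.
apply: DeriveDef => //; rewrite derive_mx//.
by apply/matrixP => i j; rewrite [j]ord1 mxE derive_val.
Qed.

(** [increment_le_nondecreasing] is applied to [A] and to [psi1], whose linear part pays for the
    good times and whose part [psi] pays for the null set of bad times. *)
Lemma increment_le_integral_of_ae_diff_le (H : 'cV[R]_n -> R) (g : R -> R)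
    (T : R) :
  (forall x, differentiable H x) -> mu.-integrable setT (EFin \o g) -> 0 <= T ->
  {ae mu, forall t : R, 0 < t < T -> 'd H (th t) (v t) <= g t} ->
  H (th T) - H (th 0) <= \int[mu]_(s in `[0, T]) g s.
Proof.
move=> dH intg T0 Hg.
pose A t := H (th t) - \int[mu]_(s in `[0, t]) g s.
suff AT : A T - A 0 <= 0.
  by move: AT; rewrite /A set_itv1 Rintegral_set1; lra.
(* A single weight dominates both [g] and the coordinates of [v]. *)
pose W s := `|g s| + \sum_i `|v s i 0|.
have intW : mu.-integrable setT (EFin \o W).
  have -> : EFin \o W = (fun s => `|g s|%:E + \sum_i `|v s i 0|%:E)%E.
    by apply/funext => s; rewrite sumEFin.
  apply: integrableD => //; first exact: integrable_norm.
  by apply: integrable_sum => // i _; apply: integrable_norm; exact: intv.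
have gW s : `|g s| <= W s by rewrite lerDl sumr_ge0.
have vW s i : `|v s i 0| <= W s.
  rewrite /W (bigD1 i)//= addrCA lerDl addr_ge0// sumr_ge0//.
have W0 s : 0 <= W s by rewrite (le_trans _ (gW s)).
(* Time 0 is counted as bad, because the derivatives are available at positive times only. *)
pose good := [set t : R | [/\ 0 < t -> is_derive t 1 th (v t),
   0 < t -> is_derive t 1 (fun s => \int[mu]_(x in `[0, s]) g x) (g t),
   0 < t < T -> 'd H (th t) (v t) <= g t & t <> 0]].
have null_bad : mu.-negligible (~` good).
  have ne0 : {ae mu, forall t : R, t <> 0}.
    exists [set 0]; split => //; first exact: lebesgue_measure_set1.
    by move=> t /= /contrapT.
  have F := ae_filter_ringOfSetsType mu.
  apply: (@filterS3 _ _ F _ _ _ good _ ae_is_derive_primitive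
    (ae_is_derive_integral _ _ intg) (@filterI _ _ F _ _ Hg ne0)).
  by move=> t dv dg [Ht t0]; split.
rewrite -[leRHS]add0r; apply/ler_addgt0Pr => e e0; rewrite addr0.
have e20 : 0 < e / 2 by rewrite divr_gt0.
have [psi [nd_psi psi_bd psi_incr]] := null_set_weight _ W _ _ intW W0 null_bad e20.
(* The linear part rises by at most [e / 2] on [[0, T]], as [psi] does; dividing by [T + 1] covers
   [T = 0]. *)
pose e1 := e / 2 / (T + 1).
have e10 : 0 < e1 by rewrite !divr_gt0// ltr_wpDl.
have e1T : e1 * T <= e / 2.
  rewrite /e1 mulrAC ler_pdivrMr ?ltr_wpDl// ler_pM2l//; lra.
pose psi1 s := psi s + e1 * s.
apply: (@le_trans _ _ (psi1 T - psi1 0)); last first.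
  rewrite /psi1 mulr0; have := psi_bd T; have := psi_bd 0; lra.
apply: increment_le_nondecreasing => //.
- move=> t /andP[t0 _]; apply: cvgB; last first.
    have int0t : mu.-integrable `[0, t] (EFin \o g) by exact: integrableS intg.
    exact: (parameterized_integral_cvg_at_left t0 int0t).
  apply: continuous_cvg; last exact: primitive_left_continuous.
  exact: differentiable_continuous.
- move=> s t st; rewrite lerD ?nd_psi// ler_pM2l//.
move=> t /andP[t0 tT].
have [[dth dg Hgt tne0]|bad] := pselect (good t).
  have tp : 0 < t by rewrite lt_def t0 andbT; exact/eqP.
  have {}dth := dth tp.
  have {}dg := dg tp.
  have dA : is_derive t 1 A ('d H (th t) (v t) - g t).
    apply: is_deriveB.
    have difft : differentiable th t by apply/derivable1_diffP.
    have diffHt : differentiable (H \o th) t by exact: differentiable_comp.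
    apply: DeriveDef; first exact/derivable1_diffP.
    rewrite deriveE// diff_comp//= -(deriveE _ difft).
    by case: dth => _ ->.
  have /(is_derive_near_right _ _ _ _ _ dA) : 'd H (th t) (v t) - g t < e1.
    rewrite (le_lt_trans _ e10)// subr_le0 Hgt// tp tT//.
  move=> near_t; near=> s.
  have As : A s - A t <= e1 * (s - t) by near: s; exact: near_t.
  have ts : t < s by near: s; exact: nbhs_right_gt.
  by have := nd_psi _ _ (ltW ts); rewrite /psi1; lra.
(* At a bad time, [H] is Lipschitz near [th t] with constant [C]. The increment of [A] is thus at
   most [(C + 1) * w], and [psi] outgrows every integer multiple of [w]. *)
have [C C0 HC] := differentiable_near_lipschitz _ _ _ _ _ (dH (th t)).
have [r /= r0 Hr] := (nbhs_ballP _ _).1 HC.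
near=> s.
have ts : t < s by near: s; exact: nbhs_right_gt.
pose w := \int[mu]_(x in `]t, s]) W x.
have w0 : 0 <= w by exact: Rintegral_ge0.
have wr : w < r.
  rewrite /w; near: s; exact: (cvgr_lt _ (integral_oc_cvg0 _ _ _ intW)).
have psis : (Num.truncn (C + 1)).+1%:R * w <= psi s - psi t.
  by rewrite /w; near: s; exact: psi_incr.
have tsw : `|th s - th t| <= w.
  by apply: norm_col_increment_le => //; rewrite t0 ltW.
have gsw : `|\int[mu]_(x in `[0, s]) g x - \int[mu]_(x in `[0, t]) g x| <= w.
  by apply: norm_increment_integral_le => //; rewrite t0 ltW.
have Hsw : `|H (th s) - H (th t)| <= C * w.
  have /= H1 : ball (th t) r (th s).
    by rewrite -ball_normE /ball_/= distrC (le_lt_trans tsw).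
  by apply: le_trans (Hr _ H1) _; rewrite ler_pM2l.
have Cw : (C + 1) * w <= (Num.truncn (C + 1)).+1%:R * w.
  rewrite ler_wpM2r// ltW// truncnS_gt//.
have e1s : 0 <= e1 * (s - t) by rewrite mulr_ge0 ?(ltW e10)// subr_ge0 ltW.
move: gsw Hsw; rewrite !ler_norml /psi1 /A => /andP[g1 g2] /andP[h1 h2].
lra.
Unshelve. all: by end_near. Qed.

End ChainRuleInequality.

(** * Increments along Caratheodory solutions *)

Section SolutionIncrement.
Context {R : realType} {n : nat}.
Notation mu := (@lebesgue_measure R).

(** A solution has an integrable velocity on bounded intervals only. Extending [v] and [g] by 0
    outside [[0, T]] makes them integrable on the line, and the primitive [th'] of the extension
    agrees with [th] on [[0, T]]. *)
Lemma solution_increment_le_of_ae (v th : R -> 'cV[R]_n) (x0 : 'cV[R]_n)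
    (H : 'cV[R]_n -> R) (g : R -> R) (T : R) :
  (forall x, differentiable H x) -> solution v x0 th -> 0 <= T ->
  mu.-integrable `[0, T] (EFin \o g) ->
  {ae mu, forall t : R, 0 < t < T -> 'd H (th t) (v t) <= g t} ->
  H (th T) - H x0 <= \int[mu]_(s in `[0, T]) g s.
Proof.
move=> dH sol T0 intg Hg.
pose D : set R := `[0, T]%classic.
have mD : measurable (D : set (measurableTypeR R)) by exact: measurable_itv.
pose v' s : 'cV[R]_n := \col_i ((fun s => v s i 0) \_ D) s.
pose th' t : 'cV[R]_n := \col_i (x0 i 0 + \int[mu]_(s in `[0, t]) v' s i 0).
have intv' i : mu.-integrable setT (fun s => (v' s i 0)%:E).
  have -> : (fun s => (v' s i 0)%:E) = (fun s => (v s i 0)%:E) \_ D.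
    apply/funext => s; rewrite mxE.
    by have := congr1 (fun f => f s) (restrict_EFin (fun s => v s i 0) D).
  have [intvi _] := sol T i T0.
  exact: (integrable_mkcond (mu:=mu) (fun s => (v s i 0)%:E) mD).1 intvi.
have th'E t i : th' t i 0 = x0 i 0 + \int[mu]_(s in `[0, t]) v' s i 0.
  by rewrite mxE.
have inD t s : t <= T -> s \in `[0, t]%classic -> s \in D.
  move=> tT; rewrite !inE/= !in_itv/= => /andP[s0 st].
  by apply/andP; split => //; exact: le_trans st tT.
have vE s : s \in D -> v' s = v s.
  by move=> sD; apply/matrixP => i j; rewrite [j]ord1 mxE patchE sD.
have thE t : 0 <= t <= T -> th' t = th t.
  move=> /andP[t0 tT]; apply/matrixP => i j; rewrite [j]ord1 th'E.
  have [_ ->] := sol t i t0; congr (_ + _).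
  by apply: eq_Rintegral => s st; rewrite vE// (inD t).
have th0 : th' 0 = x0.
  by apply/matrixP => i j; rewrite [j]ord1 th'E set_itv1 Rintegral_set1 addr0.
have intg' : mu.-integrable setT (EFin \o (g \_ D)).
  by rewrite -restrict_EFin; exact: (integrable_mkcond (mu:=mu) _ mD).1 intg.
rewrite -[x0]th0 -thE ?T0 ?lexx//.
have -> : \int[mu]_(s in `[0, T]) g s = \int[mu]_(s in `[0, T]) (g \_ D) s.
  by apply: eq_Rintegral => s sD; rewrite patchE sD.
apply: (increment_le_integral_of_ae_diff_le v' th' x0) => //.
move: Hg; apply: filterS; first exact: (ae_filter_ringOfSetsType mu).
move=> t + t0T => /(_ t0T).
have tT : 0 <= t <= T by case/andP: t0T => /ltW -> /ltW.
have tD : t \in D by rewrite inE /D /= in_itv.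
by rewrite thE// vE// patchE tD.
Qed.

(** The bound [r] is replaced by the integrable [p - q k], where [q k] is the negative part cut off
    at [k]. This bounds the integral of [q k] uniformly in [k], hence that of the negative part by
    monotone convergence. *)
Lemma solution_increment_le_integral (v th : R -> 'cV[R]_n) (x0 : 'cV[R]_n)
    (H : 'cV[R]_n -> R) (r : R -> \bar R) (T : R) :
  (forall x, differentiable H x) -> solution v x0 th -> 0 <= T ->
  measurable_fun `[0, T] r ->
  (\int[mu]_(s in `[0%R, T]) r^\+ s < +oo)%E ->
  (forall s : R, 0 <= s -> (('d H (th s) (v s))%:E <= r s)%E) ->
  ((H (th T) - H x0)%:E <= \int[mu]_(s in `[0%R, T]) r s)%E.
Proof.
move=> dH sol T0 mr rpoo Hr.
pose D : set R := `[0, T]%classic.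
have mD : measurable (D : set (measurableTypeR R)) by exact: measurable_itv.
have mrp : measurable_fun D (r^\+)%E by exact: measurable_funepos.
have mrn : measurable_fun D (r^\-)%E by exact: measurable_funeneg.
have int_rp : mu.-integrable D (r^\+)%E.
  apply/integrableP; split => //.
  by under eq_integral do rewrite gee0_abs//.
have rp_fin : {ae mu, forall s : R, D s -> ((r^\+)%E s \is a fin_num)%E}.
  exact: integrable_ae.
(* [fine] turns [+oo] into 0, which happens on a null set only. *)
pose p s := fine ((r^\+)%E s).
have mp : measurable_fun D p by exact: measurableT_comp.
have int_p : mu.-integrable D (EFin \o p).
  apply: le_integrable int_rp => //; first exact/measurable_EFinP.
  move=> s _ /=; rewrite /p; have := funepos_ge0 r s.
  by case: ((r^\+)%E s) => //= _; rewrite normr0 leey.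
have int_pE : (\int[mu]_(s in D) r^\+ s = \int[mu]_(s in D) (p s)%:E)%E.
  apply: ae_eq_integral => //; first exact/measurable_EFinP.
  move: rp_fin; apply: filterS; first exact: (ae_filter_ringOfSetsType mu).
  by move=> s fin Ds; rewrite /p fineK// fin.
pose q k s := mine ((r^\-)%E s) k%:R%:E.
have q0 k s : (0 <= q k s)%E.
  by rewrite /q le_min funeneg_ge0 lee_fin ler0n.
have qk k s : (q k s <= k%:R%:E)%E by rewrite /q ge_min lexx orbT.
have qfin k s : q k s \is a fin_num.
  by rewrite ge0_fin_numE// (le_lt_trans (qk _ _))// ltry.
have mq k : measurable_fun D (q k) by exact: measurable_mine.
have int_q k : mu.-integrable D (q k).
  apply: (@le_integrable _ _ _ mu D mD _ (cst k%:R%:E)) => //; first exact: mq.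
    by move=> s _; rewrite !gee0_abs//= lee_fin ler0n.
  apply/integrableP; split => //.
  rewrite integral_cst//= ger0_norm// lte_mul_pinfty ?lee_fin//.
  by rewrite /D lebesgue_measure_itv/= lte_fin; case: ifP => _; rewrite ?ltry// ltry.
pose I := \int[mu]_(s in D) p s.
have IE : (\int[mu]_(s in D) r^\+ s = I%:E)%E.
  by rewrite int_pE /I /Rintegral fineK//; exact: integrable_fin_num.
pose dF := H (th T) - H x0.
have int_fq k : mu.-integrable D (EFin \o (fine \o q k)).
  apply: eq_integrable (int_q k) => // s _ /=.
  by rewrite fineK.
have q_le k : (\int[mu]_(s in D) q k s <= (I - dF)%:E)%E.
  have -> : (\int[mu]_(s in D) q k s = (\int[mu]_(s in D) fine (q k s))%:E)%E.
    rewrite /Rintegral.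
    under [in RHS]eq_integral do rewrite fineK//.
    by rewrite fineK//; exact: integrable_fin_num.
  rewrite lee_fin lerBrDr addrC -lerBrDr.
  rewrite -RintegralB//; last exact: int_fq.
  apply: (solution_increment_le_of_ae v th x0) => //.
    have intpq := integrableB mD int_p (int_fq k); exact: intpq.
  move: rp_fin; apply: filterS; first exact: (ae_filter_ringOfSetsType mu).
  move=> s fins /andP[/ltW s0 /ltW sT].
  have {fins} : ((r^\+)%E s \is a fin_num)%E.
    by apply: fins; rewrite /D/= in_itv/= s0.
  have := Hr s s0; rewrite /q /p funeposE funenegE.
  case: (r s) => [x| |] //=.
  rewrite lee_fin -!EFin_max -EFin_min /= => Hx _.
  apply: le_trans Hx _.
  have := ler0n R k.
  rewrite /Num.min /Num.max; do ?case: ifP; lra.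
have rnE : (\int[mu]_(s in D) r^\- s <= (I - dF)%:E)%E.
  (* By [Hr], [r s] is never [-oo], so [q k s] is eventually constant in [k]. *)
  have cvq s : D s -> limn (fun k => q k s) = (r^\-)%E s.
    rewrite /D /= in_itv/= => /andP[s0 _].
    rewrite /q funenegE; have := Hr s s0.
    case: (r s) => [x| |] //= _; apply: lim_near_cst => //; near=> k;
      apply/min_idPl; rewrite ge_max ?leNye !lee_fin ler0n//= andbT.
    by near: k; exact: nbhs_infty_ger.
  have -> : (\int[mu]_(s in D) r^\- s =
      \int[mu]_(s in D) limn (fun k => q k s))%E.
    by apply: eq_integral => s; rewrite inE => /cvq ->.
  have ndq s : D s -> nondecreasing_seq (fun k => q k s).
    move=> _ k1 k2 k12; rewrite /q le_min ge_min lexx/=.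
    by rewrite ge_min lee_fin ler_nat k12 orbT.
  rewrite monotone_convergence//.
  apply: lime_le; last exact: nearW.
  by apply: ereal_nondecreasing_is_cvgn => k1 k2 k12; apply: ge0_le_integral => //;
    [exact: mq|exact: mq|move=> s Ds; exact: ndq].
rewrite integralE IE -/dF.
(* The integral of the negative part is finite, so it can be moved across the inequality. *)
rewrite leeBrDr; last first.
  rewrite ge0_fin_numE; last exact: integral_ge0.
  by rewrite (le_lt_trans rnE)// ltry.
by rewrite addeC -leeBrDr// -EFinB.
Unshelve. all: by end_near. Qed.

End SolutionIncrement.

(** * Pointwise bounds on the running cost *)

Section CostComparison.
Context {R : realType} {n : nat}.
Implicit Types (h : 'cV[R]_n -> R) (x u w : 'cV[R]_n).

Lemma diff_grad h x u : differentiable h x -> 'd h x u = (grad h x *m u) 0 0.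
Proof.
move=> dh; rewrite [in LHS](matrix_sum_delta u) linear_sum mxE.
apply: eq_bigr => i _; rewrite big_ord1 linearZ /= mxE deriveE// mulrC.
by [].
Qed.

Lemma enorm_sq p q (A : 'M[R]_(p, q)) :
  enorm A ^+ 2 = \sum_i \sum_j A i j ^+ 2.
Proof.
by rewrite sqr_sqrtr// sumr_ge0// => i _; rewrite sumr_ge0// => j _; exact: sqr_ge0.
Qed.

Lemma enorm_eq0 p q (A : 'M[R]_(p, q)) : enorm A ^+ 2 = 0 -> A = 0.
Proof.
rewrite enorm_sq => /eqP; rewrite psumr_eq0 => [/allP A0|i _]; last first.
  by rewrite sumr_ge0// => j _; exact: sqr_ge0.
apply/matrixP => i j; rewrite mxE.
have := A0 i (mem_index_enum i); rewrite psumr_eq0 => [/allP Ai|k _]; last first.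
  exact: sqr_ge0.
by have := Ai j (mem_index_enum j); rewrite sqrf_eq0 => /eqP.
Qed.

Lemma enorm_subZ_sq (a : 'rV[R]_n) w (c : R) :
  enorm (w - c *: a^T) ^+ 2 =
  enorm w ^+ 2 - 2 * c * (a *m w) 0 0 + c ^+ 2 * enorm a ^+ 2.
Proof.
rewrite !enorm_sq [X in _ + _ * X]big_ord1 mxE !mulr_sumr -sumrB -big_split /=.
by apply: eq_bigr => i _; rewrite !big_ord1 !mxE; ring.
Qed.

Lemma mul_row_trmx (a : 'rV[R]_n) : (a *m a^T) 0 0 = enorm a ^+ 2.
Proof.
by rewrite enorm_sq big_ord1 mxE; apply: eq_bigr => i _; rewrite mxE expr2.
Qed.

Lemma mulmx_addr_entry (a : 'rV[R]_n) u w :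
  (a *m (u + w)) 0 0 = (a *m u) 0 0 + (a *m w) 0 0.
Proof. by rewrite mulmxDr mxE. Qed.

Variables (h : 'cV[R]_n -> R) (alpha : R -> R) (beta : R).
Hypothesis cbf : is_CBF h alpha.

Lemma deficit_ge0 x u : 0 <= deficit h alpha x u.
Proof. by rewrite /deficit le_max lexx. Qed.

(** The CBF condition enters here: where the gradient vanishes, the deficit reduces to the maximum
    of 0 and [- alpha (h x)], which is 0. *)
Lemma enorm_grad_neq0 x u : deficit h alpha x u != 0 -> enorm (grad h x) ^+ 2 != 0.
Proof.
apply: contraNneq => /enorm_eq0 g0; rewrite /deficit g0 mul0mx mxE oppr0 add0r.
by apply/eqP/max_idPl; rewrite oppr_le0 cbf.
Qed.

(** Where the deficit [m] is positive, the two sides differ by [beta * (beta - 2) * m]; where it is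
    0, [- alpha (h x)] bounds the drift term from below. *)
Lemma state_cost_ge x u :
  2 <= beta -> - (2 * beta * alpha (h x)) <= state_cost h alpha beta x u.
Proof.
move=> b2; rewrite /state_cost /deficit.
set a := (grad h x *m u) 0 0; set al := alpha (h x).
have [m_le0|m_gt0] := leP (- a - al) 0.
  by rewrite mulr0 addr0 -subr_ge0 opprK -mulrDr mulr_ge0//; lra.
rewrite -subr_ge0.
have -> : 2 * beta * a + beta ^+ 2 * (- a - al) - - (2 * beta * al) =
  beta * ((beta - 2) * (- a - al)) by ring.
by rewrite mulr_ge0 ?mulr_ge0//; lra.
Qed.

Lemma cost_ge x u w :
  ((2 * beta * (grad h x *m (u + w)) 0 0)%:E <=
   (state_cost h alpha beta x u)%:E + penalty h alpha x u w)%E.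
Proof.
rewrite /penalty /state_cost mulmx_addr_entry; set a := (_ *m u) 0 0.
have m0 := deficit_ge0 x u; set m := deficit _ _ _ _ in m0 *.
case: ifPn => [/eqP mE|mN0].
  case: ifPn => [/eqP ->|_]; last by rewrite addey// leey.
  by rewrite adde0 mulmx0 mxE mE lee_fin mulr0 !addr0.
have G0 := enorm_grad_neq0 _ _ mN0.
rewrite -EFinD lee_fin -subr_ge0.
(* Completing the square: this term is exactly the difference of the two sides. *)
have : 0 <= enorm (grad h x) ^+ 2 / m *
    enorm (w - (beta * m / enorm (grad h x) ^+ 2) *: (grad h x)^T) ^+ 2.
  by rewrite mulr_ge0 ?divr_ge0 ?sqr_ge0.
rewrite enorm_subZ_sq; set G := enorm (grad h x) ^+ 2 in G0 *.
by congr (is_true (0 <= _)); field; rewrite mN0 G0.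
Qed.

Lemma cost_QP x u :
  ((state_cost h alpha beta x u)%:E + penalty h alpha x u (beta *: uQP h alpha x u) =
   (2 * beta * (grad h x *m (u + beta *: uQP h alpha x u)) 0 0)%:E)%E.
Proof.
rewrite /penalty /state_cost /uQP mulmx_addr_entry; set a := (_ *m u) 0 0.
set m := deficit _ _ _ _.
(* With zero deficit the correction is 0, so the penalty takes its finite value. *)
case: ifPn => [/eqP ->|mN0].
  by rewrite mul0r scale0r scaler0 eqxx mulmx0 mxE adde0 mulr0 !addr0.
have G0 := enorm_grad_neq0 _ _ mN0.
rewrite scalerA -scalemxAr [fun_of_matrix (_ *: _) _ _]mxE mul_row_trmx.
(* The norm of a multiple is read off the expansion of the square at [w = 0]. *)
have -> c : enorm (c *: (grad h x)^T) ^+ 2 = c ^+ 2 * enorm (grad h x) ^+ 2.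
  have := enorm_subZ_sq (grad h x) 0 (- c).
  rewrite mulmx0 mxE scaleNr opprK add0r => ->.
  rewrite enorm_sq big1 => [|i _]; last first.
    by rewrite big1 // => j _; rewrite mxE expr0n.
  by rewrite sqrrN; ring.
set G := enorm (grad h x) ^+ 2 in G0 *.
by rewrite -EFinD; congr (_%:E); field; rewrite mN0 G0.
Qed.

End CostComparison.

(** * Bounds on the cost up to a finite time *)

Section CostBounds.
Context {R : realType} {n : nat} {X : Type}.
Notation mu := (@lebesgue_measure R).
Variables (h : 'cV[R]_n -> R) (alpha : R -> R) (beta : R).
Variable u0 : 'cV[R]_n -> X -> R -> 'cV[R]_n.
Variables (xi_sys : (R -> 'cV[R]_n) -> (R -> X) -> Prop).
Hypothesis dh : forall x, differentiable h x.
Hypothesis cbf : is_CBF h alpha.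

Lemma diff_scale_grad (c : R) x u :
  'd (fun y => c * h y) x u = c * (grad h x *m u) 0 0.
Proof.
have -> : (fun y => c * h y) = c \*: h by [].
by rewrite diffZ// -diff_grad.
Qed.

(** If the positive part has a finite integral, the increment of [2 * beta * h] is compared with the
    running cost; otherwise [has_integral] makes the negative part integrable and the cost is
    [+oo]. *)
Lemma cost_upto_ge th0 xi0 th xi w (t : R) :
  admissible h alpha beta u0 xi_sys th0 xi0 th xi w -> 0 <= t ->
  ((- (2 * beta * h th0))%:E <= cost_upto h alpha beta u0 th xi w t)%E.
Proof.
move=> [_ sol _ hasint _] t0; rewrite /cost_upto.
set r := running_cost h alpha beta u0 th xi w.
have [mr rposneg] := hasint t t0.
have [rp|rp] := ltP (\int[mu]_(s in `[0%R, t]) r^\+ s)%E +oo%E.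
  have incr : ((2 * beta * h (th t) - 2 * beta * h th0)%:E <=
      \int[mu]_(s in `[0%R, t]) r s)%E.
    apply: (solution_increment_le_integral _ _ _ (fun y => 2 * beta * h y)
      _ _ _ sol t0 mr rp) => [x|s _].
      exact: differentiableZ.
    by rewrite diff_scale_grad; exact: cost_ge.
  apply: le_trans (leeD2l _ incr).
  by rewrite -EFinD lee_fin; lra.
rewrite integralE.
have -> : (\int[mu]_(s in `[0%R, t]) r^\+ s = +oo)%E.
  by apply/eqP; rewrite eq_le leey.
case: rposneg => [|rn]; first by rewrite ltNge rp.
rewrite [X in (_ + X)%E]addye ?addey ?leey//.
by rewrite -ltNye lteNr.
Qed.

(** Here the running cost equals the derivative term, so the increment bound also applies to
    [- (2 * beta) * h] and the negated cost, whose positive part is the negative part of [r]. If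
    that part has infinite integral, the cost is [-oo]. *)
Lemma cost_upto_QP_le th0 xi0 th xi (t : R) :
  admissible h alpha beta u0 xi_sys th0 xi0 th xi
    (QP_correction h alpha beta u0 th xi) -> 0 <= t ->
  (cost_upto h alpha beta u0 th xi (QP_correction h alpha beta u0 th xi) t <=
   (- (2 * beta * h th0))%:E)%E.
Proof.
set w := QP_correction _ _ _ _ _ _.
move=> [_ sol _ hasint _] t0; rewrite /cost_upto.
set r := running_cost h alpha beta u0 th xi w.
have [mr rposneg] := hasint t t0.
have rE s : r s = (2 * beta *
    (grad h (th s) *m (u0 (th s) (xi s) s + w s)) 0 0)%:E by exact: cost_QP.
have [rn|rn] := ltP (\int[mu]_(s in `[0%R, t]) r^\- s)%E +oo%E.
  have incr : ((- (2 * beta) * h (th t) - - (2 * beta) * h th0)%:E <=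
      \int[mu]_(s in `[0%R, t]) (\- r) s)%E.
    apply: (solution_increment_le_integral _ _ _ (fun y => - (2 * beta) * h y)
      _ _ _ sol t0) => [x| | |s _].
    - exact: differentiableZ.
    - exact: measurableT_comp.
    - by rewrite funeposN.
    - by rewrite diff_scale_grad rE -EFinN mulNr.
  move: incr; rewrite (_ : (\int[mu]_(s in `[0%R, t]) (\- r) s =
    - \int[mu]_(s in `[0%R, t]) r s)%E); last first.
    apply: integralN; rewrite fin_num_adde_defl// fin_numN.
    by rewrite ge0_fin_numE// integral_ge0.
  case: (\int[mu]_(s in `[0%R, t]) r s)%E => [x| |] //=.
    by rewrite -EFinD !lee_fin; lra.
  by rewrite addeNy leNye.
rewrite integralE.
have -> : (\int[mu]_(s in `[0%R, t]) r^\- s = +oo)%E.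
  by apply/eqP; rewrite eq_le leey.
case: rposneg => [rp|]; last by rewrite ltNge rn.
by rewrite addeNy ?addeNy ?leNye// -ltey.
Qed.

End CostBounds.

Theorem theorem12 (R : realType) (n : nat) (X : Type)
    (h : 'cV[R]_n -> R) (alpha : R -> R) (beta : R)
    (u0 : 'cV[R]_n -> X -> R -> 'cV[R]_n)
    (xi_sys : (R -> 'cV[R]_n) -> (R -> X) -> Prop) :
  barrier_candidate h -> class_Kh h alpha -> is_CBF h alpha -> 2 <= beta ->
  (forall (x : 'cV[R]_n) (z : X) (t : R),
     - (2 * beta * alpha (h x)) <= state_cost h alpha beta x (u0 x z t)) /\
  (forall (th0 : 'cV[R]_n) (xi0 : X) (ths : R -> 'cV[R]_n) (xis : R -> X),
     admissible h alpha beta u0 xi_sys th0 xi0 ths xis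
       (QP_correction h alpha beta u0 ths xis) ->
     forall (th : R -> 'cV[R]_n) (xi : R -> X) (w : R -> 'cV[R]_n),
       admissible h alpha beta u0 xi_sys th0 xi0 th xi w ->
       (J h alpha beta u0 ths xis (QP_correction h alpha beta u0 ths xis)
          <= J h alpha beta u0 th xi w)%E).
Proof.
move=> [dh _] _ cbf beta2; split=> [x z t|]; first exact: state_cost_ge.
move=> th0 xi0 ths xis adm_s th xi w adm.
(* This constant depends only on the common initial estimate and separates the two costs at every
   time [t >= 0]; both limits exist by admissibility. *)
apply: (@le_trans _ _ (- (2 * beta * h th0))%:E).
  apply: lime_le; first by case: adm_s.
  near=> t.
  have t0 : 0 <= t by near: t; exact: nbhs_pinfty_ge.
  exact: cost_upto_QP_le adm_s t0.
apply: lime_ge; first by case: adm.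
near=> t.
have t0 : 0 <= t by near: t; exact: nbhs_pinfty_ge.
exact: cost_upto_ge adm t0.
Unshelve. all: by end_near. Qed.
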